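(* Let $(p_\alpha:\alpha<\mathfrak{c})$ be a family of real numbers in $(0,1)$. Then there exists a $\mathsf{d}$-independent family $\{A_\alpha:\alpha<\mathfrak{c}\}$ (indexed without repetitions, i.e. $A_\alpha\ne A_\beta$ for $\alpha\neq\beta$) such that $\mathsf{d}(A_\alpha)=p_\alpha$ for each $\alpha<\mathfrak{c}$.
   Context: Let $\omega=\{0,1,2,\ldots\}$ and identify $n\in\omega$ with $\{0,\ldots,n-1\}$. $\mathcal{D}$ is the family of all $A\subseteq\omega$ for which the asymptotic density $\mathsf{d}(A):=\lim_{n\to\infty}|A\cap n|/n$ exists. For $\mathcal{A}\subseteq\mathcal{P}(\omega)$, $\langle\mathcal{A}\rangle$ denotes the field of subsets of $\omega$ generated by $\mathcal{A}$. A nonempty family $\mathcal{A}\subseteq\mathcal{D}$ is $\mathsf{d}$-independent if: (1) $\mathsf{d}(A)\in(0,1)$ for all $A\in\mathcal{A}$; (2) $\langle\mathcal{A}\rangle\subseteq\mathcal{D}$; (3) $\mathsf{d}(\bigcap\mathcal{F})=\prod_{A\in\mathcal{F}}\mathsf{d}(A)$ for every nonempty finite $\mathcal{F}\subseteq\mathcal{A}$. $\mathfrak{c}=2^{\aleph_0}$. *)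

(* Defs.v *)
From mathcomp Require Import all_boot all_order all_algebra.
From mathcomp Require Import all_classical all_reals all_analysis.

Set Implicit Arguments.
Unset Strict Implicit.
Unset Printing Implicit Defensive.

Import Order.TTheory GRing.Theory Num.Theory.
Import numFieldNormedType.Exports.

Local Open Scope classical_set_scope.
Local Open Scope ring_scope.

(* |A \cap {0, ..., n-1}| / n; the value 0 at n = 0 does not affect limits. *)
Definition density_ratio (R : realType) (A : set nat) (n : nat) : R :=
  #|[pred k : 'I_n | (k : nat) \in A]|%:R / n%:R.

Definition has_density (R : realType) (A : set nat) : Prop :=
  cvgn (density_ratio R A).

(* Only meaningful when [has_density R A] holds. *)
Definition density (R : realType) (A : set nat) : R :=
  limn (density_ratio R A).

Definition field_of_sets (T : Type) (G : set (set T)) : Prop :=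
  [/\ G set0, setC_closed G & setU_closed G].

Definition generated_field (T : Type) (G : set (set T)) : set (set T) :=
  smallest (@field_of_sets T) G.

Definition d_independent (R : realType) (F : set (set nat)) : Prop :=
  [/\ F !=set0,
      F `<=` has_density R,
      forall A, F A -> 0 < density R A < 1,
      generated_field F `<=` has_density R &
      forall G : set (set nat), G `<=` F -> finite_set G -> G !=set0 ->
        density R (\bigcap_(A in G) A) = \big[*%R/1]_(A \in G) density R A].

(* Main.v *)
(* Fix an injection [e] of the index set into the subsets of [nat], and cut
   [nat] into stages, stage k being the interval where a slow function K takes
   the value k. On stage k one runs periodically through all functions f from
   the subsets of {0, ..., k-1} to {0, ..., k}, and n is put into the set A_i
   when f (e i `&` {0, ..., k-1}) < p_i (k+1). Finitely many distinct codes
   [e i] have distinct restrictions to {0, ..., k-1} once k is large, so within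
   a period the corresponding conditions are exactly independent and the i-th
   one has frequency tending to p_i. Stages being much longer than periods,
   these frequencies are the densities. The indicator of a member of the
   generated field is a linear combination of indicators of finite
   intersections, hence has a Cesaro mean. *)
Require Import Defs.
From mathcomp Require Import all_boot all_order all_algebra.
From mathcomp Require Import all_classical all_reals all_analysis.
From mathcomp Require Import ring lra.

Set Implicit Arguments.
Unset Strict Implicit.
Unset Printing Implicit Defensive.

Import Order.TTheory GRing.Theory Num.Theory.
Import numFieldNormedType.Exports.
Local Open Scope classical_set_scope.
Local Open Scope card_scope.
Local Open Scope ring_scope.

(** * Densities as Cesaro means, and slowly growing stage functions *)

Lemma density_ratioE (R : realType) (A : set nat) (n : nat) :
  density_ratio R A n = series (\1_A : nat -> R) n / n%:R.
Proof.
rewrite /density_ratio /series/=; congr (_ / _).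
rewrite big_mkord -sum1_card natr_sum big_mkcond /=.
by apply: eq_bigr => i _; rewrite indicE inE; case: ifP.
Qed.

Lemma cvg_mean (R : realType) (u : nat -> R) (l : R) :
  u n @[n --> \oo] --> l -> series u n / n%:R @[n --> \oo] --> l.
Proof.
move=> /cesaro; rewrite /arithmetic_mean => ul.
rewrite -(cvg_shiftS (fun n => series u n / n%:R)).
by under eq_fun do rewrite mulrC.
Qed.

(** [V k] stands for the error accumulated up to stage [k]; the third clause makes it at most
    [n / K n], hence negligible against [n]. [K] is greedy: it moves on as soon as this clause
    permits, so no value is kept forever. *)
Lemma slow_stage (V : nat -> nat) : exists K : nat -> nat,
  [/\ K 0%N = 0%N,
      forall n, K n.+1 = K n \/ K n.+1 = (K n).+1,
      forall n, (K n * V (K n) <= n)%N &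
      K n @[n --> \oo] --> \oo].
Proof.
pose next n k := if (k.+1 * V k.+1 <= n.+1)%N then k.+1 else k.
pose K := fix K n := if n is m.+1 then next m (K m) else 0%N.
have KS n : K n.+1 = next n (K n) by [].
have Kstep n : K n.+1 = K n \/ K n.+1 = (K n).+1.
  by rewrite KS /next; case: ifP; [right|left].
have Kmono : {homo K : m n / (m <= n)%N}.
  apply: homo_leq => [//| |n]; first exact: leq_trans.
  by case: (Kstep n) => ->.
exists K; split=> //.
  elim=> [//|n IHn]; rewrite KS /next; case: ifP => // _.
  exact: leq_trans IHn _.
apply/cvgnyPge => c.
suff [N cN] : exists N, (c <= K N)%N.
  by exists N => // n /= Nn; apply: leq_trans cN _; exact: Kmono.
elim: c => [|c [N]]; first by exists 0%N.
rewrite leq_eqVlt => /orP[/eqP cN|?]; last by exists N.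
(* By time [m], [K] has reached [c] and the threshold for [c.+1] is passed: either [K m] already
   exceeds [c], or the next step increments it. *)
pose m := maxn N (c.+1 * V c.+1); exists m.+1.
have : (c <= K m)%N by rewrite cN Kmono// leq_maxl.
rewrite leq_eqVlt => /orP[/eqP cm|cm]; last exact: leq_trans cm (Kmono _ _ _).
by rewrite KS /next -cm ifT// leqW// leq_maxr.
Qed.

(** * Exact counts over a period, and means of staged periodic sequences *)

(** Full periods cancel, so only an incomplete last period of at most [M] terms counts. *)
Lemma series_periodic_le (R : realType) (h : nat -> R) (M : nat) :
  (0 < M)%N -> (forall n, h (n + M)%N = h n) -> (forall n, `|h n| <= 1) ->
  series h M = 0 -> forall n, `|series h n| <= M%:R.
Proof.
move=> M0 hM h1 sM.
have shift n : series h (n + M)%N = series h n.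
  rewrite /series/= addnC (big_cat_nat _ (n := M))//= ?leq_addr//.
  rewrite -[X in X + _]/(series h M) sM add0r.
  rewrite -{1}[M]add0n big_addn addKn.
  by apply: eq_bigr => i _; rewrite hM.
have small n : (n <= M)%N -> `|series h n| <= M%:R.
  move=> nM; apply: le_trans (ler_norm_sum _ _ _) _.
  apply: le_trans (ler_sum _ (fun i _ => h1 i)) _.
  by rewrite sumr_const_nat subn0 ler_nat.
elim/ltn_ind => n IHn; have [/small//|Mn] := leqP n M.
rewrite -(subnK (ltnW Mn)) shift IHn// ltn_subrL M0.
exact: leq_trans M0 (ltnW Mn).
Qed.

Lemma partition_prod (R : comPzRingType) (J : Type) (T : finType) (s : seq J)
    (r : J -> T) (c : J -> R) :
  \prod_(t : T) \prod_(x <- s | r x == t) c x = \prod_(x <- s) c x.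
Proof. by rewrite [RHS](partition_big r xpredT). Qed.

(** A uniformly random [f] has independent uniform values at the distinct points [r x], and
    [f (r x) < q x] has probability [q x / N.+1] because [q x] does not exceed the number of
    values. *)
Lemma sum_ffun_prod (R : realType) (J : eqType) (T : finType) (N : nat)
    (s : seq J) (r : J -> T) (q : J -> nat) :
  uniq [seq r x | x <- s] -> (forall x, (q x <= N.+1)%N) ->
  \sum_(f : {ffun T -> 'I_N.+1}) \prod_(x <- s) ((f (r x) < q x)%N%:R : R) =
  #|{ffun T -> 'I_N.+1}|%:R * \prod_(x <- s) ((q x)%:R / N.+1%:R).
Proof.
move=> us qN.
(* Grouping the factors by the point [t = r x] makes each group depend on [f t] alone, so that sum
   and product can be exchanged. *)
transitivity (\sum_(f : {ffun T -> 'I_N.+1})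
    \prod_t \prod_(x <- s | r x == t) ((f t < q x)%N%:R : R)).
  apply: eq_bigr => f _; rewrite -(partition_prod s r).
  by apply: eq_bigr => t _; apply: eq_bigr => x /eqP ->.
rewrite -(bigA_distr_bigA (fun t (j : 'I_N.+1) =>
  \prod_(x <- s | r x == t) ((j < q x)%N%:R : R))).
rewrite card_ffun card_ord natrX -prodr_const -(partition_prod s r) -big_split/=.
apply: eq_bigr => t _.
under eq_bigr do rewrite -big_filter.
rewrite -[X in _ * X]big_filter.
(* Distinctness of the points leaves at most one condition on each value [f t]. *)
have : (size [seq x <- s | r x == t] <= 1)%N.
  rewrite size_filter -(count_map r (pred1 t)).
  by rewrite count_uniq_mem//; case: (_ \in _).
case: [seq x <- s | r x == t] => [|x [|//]] _.
  by under eq_bigr do rewrite big_nil; rewrite big_nil mulr1 sumr_const card_ord.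
under eq_bigr do rewrite big_seq1.
rewrite big_seq1 mulrCA divff ?pnatr_eq0// mulr1.
rewrite -natr_sum; congr (_%:R).
rewrite (eq_bigr (fun i : 'I_N.+1 => if (i < q x)%N then 1%N else 0%N));
  last by move=> i _; case: ifP.
rewrite -big_mkcond/= -(big_ord_widen N.+1 (fun=> 1%N))//.
by rewrite sum1_card card_ord.
Qed.

(** A stage contributes a difference of two partial sums of the same [c k], hence at most
    [2 * M k]. *)
Lemma staged_series_le (R : realType) (M K : nat -> nat) (c : nat -> nat -> R) :
  K 0%N = 0%N -> (forall n, K n.+1 = K n \/ K n.+1 = (K n).+1) ->
  (forall k n, `|series (c k) n| <= (M k)%:R) ->
  forall n, `|series (fun n => c (K n) n) n| <=
    (\sum_(k < (K n).+1) 2 * M k)%:R.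
Proof.
move=> K0 KS cM.
(* The defect below only changes when the stage does, by at most M k + M k.+1. *)
pose D n := series (fun n => c (K n) n) n - series (c (K n)) n.
have DM n : `|D n| <= (\sum_(k < K n) (M k + M k.+1))%:R.
  elim: n => [|n IHn].
    by rewrite /D /series/= !big_geq// subrr normr0.
  have DS : D n.+1 = D n + (series (c (K n)) n.+1 - series (c (K n.+1)) n.+1).
    by rewrite /D /series/= !big_nat_recr//=; ring.
  case: (KS n) => KSn; rewrite DS KSn ?subrr ?addr0//.
  rewrite big_ord_recr natrD/=; apply: le_trans (ler_normD _ _) _.
  apply: lerD IHn _; apply: le_trans (ler_normB _ _) _.
  by rewrite natrD lerD.
move=> n; rewrite -[X in `|X|](subrK (series (c (K n)) n)).
apply: le_trans (ler_normD _ _) _.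
apply: le_trans (lerD (DM n) (cM _ _)) _.
(* The extra [M (K n)] completes one of the two sums; the other lacks only [M 0]. *)
rewrite -natrD ler_nat big_split/= -big_distrr/= mul2n -addnn addnAC.
have -> : (\sum_(i < K n) M i + M (K n) = \sum_(i < (K n).+1) M i)%N.
  by rewrite big_ord_recr.
rewrite leq_add2l.
by rewrite [leqRHS]big_ord_recl leq_addl.
Qed.

(** Split [h k] into its mean [mu k] over a period and a remainder [c k] of sum zero over a period.
    The remainders add up to at most [n / K n], and Cesaro's theorem handles the sequence
    [mu (K n)]. *)
Lemma cvg_staged_mean (R : realType) (M K : nat -> nat) (h : nat -> nat -> R)
    (l : R) :
  (forall k, 0 < M k)%N ->
  K 0%N = 0%N -> (forall n, K n.+1 = K n \/ K n.+1 = (K n).+1) ->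
  (forall n, K n * (\sum_(k < (K n).+1) 2 * M k) <= n)%N ->
  K n @[n --> \oo] --> \oo ->
  (forall k n, h k (n + M k)%N = h k n) -> (forall k n, 0 <= h k n <= 1) ->
  series (h k) (M k) / (M k)%:R @[k --> \oo] --> l ->
  series (fun n => h (K n) n) n / n%:R @[n --> \oo] --> l.
Proof.
move=> M0 K0 KS KV Koo hM h01 hl.
pose mu k : R := series (h k) (M k) / (M k)%:R.
pose c k n := h k n - mu k.
have seriesc k n : series (c k) n = series (h k) n - mu k *+ n.
  by rewrite /series/= sumrB sumr_const_nat subn0.
have mu01 k : 0 <= mu k <= 1.
  rewrite /mu divr_ge0 ?ler0n//=; last first.
    by apply: sumr_ge0 => i _; case/andP: (h01 k i).
  rewrite ler_pdivrMr ?ltr0n// mul1r.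
  have h1 i : h k i <= 1 by case/andP: (h01 k i).
  apply: le_trans (ler_sum _ (fun i _ => h1 i)) _.
  by rewrite sumr_const_nat subn0.
have cM k n : `|series (c k) n| <= (M k)%:R.
  apply: series_periodic_le => //.
  - by move=> m; rewrite /c hM.
  - move=> m; rewrite /c ler_norml; have := h01 k m; have := mu01 k; lra.
  - rewrite seriesc /mu -[X in _ - X]mulr_natr divfK ?subrr// pnatr_eq0.
    by rewrite -lt0n.
have SV := staged_series_le K0 KS cM.
have Kpos : \forall n \near \oo, (0 < K n)%N by move/cvgnyPgt: Koo; exact.
have S0 : series (fun n => c (K n) n) n / n%:R @[n --> \oo] --> (0 : R).
  apply: norm_cvg0.
  apply: (@squeeze_cvgr _ _ _ _ (fun=> 0) (fun n => (K n)%:R^-1)).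
  - near=> n.
    have n0 : (0 < n)%N by near: n; exists 1%N.
    have Kn0 : (0 < K n)%N by near: n; exact: Kpos.
    rewrite normr_ge0/= normrM (ger0_norm (_ : 0 <= n%:R^-1)) ?invr_ge0//.
    rewrite ler_pdivrMr ?ltr0n// mulrC ler_pdivlMr ?ltr0n// mulrC.
    apply: le_trans (ler_wpM2l (ler0n _ _) (SV n)) _.
    by rewrite -natrM ler_nat.
  - exact: cvg_cst.
  - have inv0 : k%:R^-1 @[k --> \oo] --> (0 : R).
      by rewrite -(cvg_shiftS (fun k => k%:R^-1 : R)); exact: cvg_harmonic.
    exact: (cvg_comp _ _ Koo inv0).
have mul : series (fun n => mu (K n)) n / n%:R @[n --> \oo] --> l.
  by apply: cvg_mean; exact: (cvg_comp _ _ Koo hl).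
rewrite -[l]add0r.
have -> : (fun n => series (fun n => h (K n) n) n / n%:R) =
    (fun n => series (fun n => c (K n) n) n / n%:R +
              series (fun n => mu (K n)) n / n%:R).
  apply/funext => n; rewrite -mulrDl; congr (_ / _).
  rewrite /series/= -big_split/=; apply: eq_bigr => i _.
  by rewrite /c subrK.
exact: cvgD S0 mul.
Unshelve. all: by end_near.
Qed.

(** * Traces of codes and the staged sets *)

(** The element [d] makes [T] nonempty, so the index taken modulo [#|T|] is always in range. *)
Definition enum_mod (T : finType) (d : T) (n : nat) : T :=
  nth d (enum T) (n %% #|T|).

Lemma enum_mod_addr (T : finType) (d : T) n :
  enum_mod d (n + #|T|) = enum_mod d n.
Proof. by rewrite /enum_mod modnDr. Qed.

Lemma series_enum_mod (V : zmodType) (T : finType) (d : T) (g : T -> V) :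
  series (fun n => g (enum_mod d n)) #|T| = \sum_x g x.
Proof.
rewrite /series/= -big_enum (big_nth d) -cardT.
by apply: eq_big_nat => i /andP[_ iT]; rewrite /enum_mod modn_small.
Qed.

Definition trace (x : set nat) (k : nat) : {set 'I_k} :=
  finset (fun j : 'I_k => (j : nat) \in x).

Lemma near_all (T : Type) (F : set_system T) (FF : Filter F) (J : eqType)
    (P : J -> T -> bool) (s : seq J) :
  (forall x, x \in s -> \forall t \near F, P x t) ->
  \forall t \near F, all (P^~ t) s.
Proof.
elim: s => [_|x s IHs Ps]; first exact: nearW.
have /IHs Pt : forall y, y \in s -> \forall t \near F, P y t.
  by move=> y ys; apply: Ps; rewrite inE ys orbT.
by apply: filterS2 Pt (Ps x (mem_head _ _)) => t /= -> ->.
Qed.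

Lemma trace_neq (x y : set nat) : x != y ->
  \forall k \near \oo, trace x k != trace y k.
Proof.
move=> xy; have [m xym] : exists m : nat, (m \in x) != (m \in y).
  apply: contrapT => xyE; move/eqP: xy; apply.
  apply/seteqP; split=> m xm; apply: contrapT => ym; apply: xyE; exists m.
    by rewrite (mem_set xm) (memNset ym).
  by rewrite (mem_set xm) (memNset ym).
exists m.+1 => // k /= mk; apply: contra xym => /eqP/setP/(_ (Ordinal mk)).
by rewrite !inE => ->.
Qed.

Lemma trace_uniq (J : eqType) (e : J -> set nat) (s : seq J) :
  injective e -> uniq s ->
  \forall k \near \oo, uniq [seq trace (e x) k | x <- s].
Proof.
move=> einj; elim: s => [_|x s IHs /= /andP[xs us]]; first exact: nearW.
have sx : \forall k \near \oo, all (fun y => trace (e x) k != trace (e y) k) s.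
  apply: near_all => y ys; apply: trace_neq; rewrite (inj_eq einj).
  by apply: contra xs => /eqP ->.
apply: filterS2 sx (IHs us) => k /= /allP xk ->; rewrite andbT.
by apply/mapP => -[y ys /eqP]; apply/negP/xk.
Qed.

Lemma cvg_truncn_ratio (R : realType) (p : R) : 0 <= p ->
  (Num.truncn (p * k.+1%:R))%:R / k.+1%:R @[k --> \oo] --> p.
Proof.
move=> p0; apply: (@squeeze_cvgr _ _ _ _ (fun k => p - harmonic k) (fun=> p)).
- apply: nearW => k; have k0 : 0 < k.+1%:R :> R by rewrite ltr0n.
  have /andP[lo hi] := truncn_itv (mulr_ge0 p0 (ltW k0)).
  rewrite ler_pdivrMr// lo andbT ler_pdivlMr// mulrBl /harmonic/=.
  by rewrite mulVf ?lt0r_neq0// lerBlDr natr1 ltW.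
- rewrite -[X in _ --> X]subr0; apply: cvgB; first exact: cvg_cst.
  exact: cvg_harmonic.
- exact: cvg_cst.
Qed.

Local Notation stage_type k := {ffun {set 'I_k} -> 'I_k.+1}.

Definition pattern (k n : nat) : stage_type k :=
  enum_mod [ffun=> ord0] n.

(** For [p] in [[0, 1]], truncating the bound makes the frequency over a period of stage [k] an
    exact fraction with denominator [k.+1], within [1 / k.+1] of [p]. *)
Definition staged_set (R : realType) (K : nat -> nat) (x : set nat) (p : R) :
    set nat :=
  [set n | (pattern (K n) n (trace x (K n)) <
            Num.truncn (p * (K n).+1%:R))%N].

Lemma indic_bigsetI (R : comPzRingType) (T J : Type) (s : seq J)
    (A : J -> set T) t :
  \1_(\big[setI/setT]_(x <- s) A x) t = \prod_(x <- s) (\1_(A x) t : R).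
Proof.
elim: s => [|x s IHs]; first by rewrite !big_nil indicT.
by rewrite !big_cons indicI/= IHs.
Qed.

(** On stage [k] the indicator of the intersection is the periodic sequence [g k (pattern k n)]; its
    mean over a period is the exact product of the single frequencies once the traces differ. *)
Lemma cvg_density_staged (R : realType) (K : nat -> nat) (J : eqType)
    (e : J -> set nat) (p : J -> R) (s : seq J) :
  K 0%N = 0%N -> (forall n, K n.+1 = K n \/ K n.+1 = (K n).+1) ->
  (forall n, K n * (\sum_(k < (K n).+1) 2 * #|stage_type k|) <= n)%N ->
  K n @[n --> \oo] --> \oo ->
  injective e -> (forall x, 0 < p x < 1) -> uniq s ->
  density_ratio R (\big[setI/setT]_(x <- s) staged_set K (e x) (p x)) n
    @[n --> \oo] --> \prod_(x <- s) p x.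
Proof.
move=> K0 KS KV Koo einj p01 us.
pose q k x := Num.truncn (p x * k.+1%:R).
pose g k (f : stage_type k) : R :=
  \prod_(x <- s) (f (trace (e x) k) < q k x)%N%:R.
under eq_fun do rewrite density_ratioE.
have -> : \1_(\big[setI/setT]_(x <- s) staged_set K (e x) (p x)) =
    (fun n => g (K n) (pattern (K n) n)).
  apply/funext => n; rewrite indic_bigsetI; apply: eq_bigr => x _.
  by rewrite indicE mem_setE.
apply: (@cvg_staged_mean R (fun k => #|stage_type k|) K
  (fun k n => g k (pattern k n))) => //.
- by move=> k; apply/card_gt0P; exists [ffun=> ord0].
- by move=> k n; rewrite /pattern enum_mod_addr.
- move=> k n; rewrite /g prodr_ge0//= prodr_ile1// => x _.
  by rewrite ler0n lern1 leq_b1.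
have pq : \prod_(x <- s) ((q k x)%:R / k.+1%:R : R) @[k --> \oo] -->
    \prod_(x <- s) p x.
  apply: cvg_big => [|x _]; first exact: mul_continuous.
  by apply: cvg_truncn_ratio; case/andP: (p01 x) => /ltW.
(* The factorization is only eventual: for small [k] distinct codes may share a trace. *)
apply: cvg_trans pq; apply: near_eq_cvg.
apply: filterS (trace_uniq einj us) => k uk.
rewrite series_enum_mod /g sum_ffun_prod//.
  rewrite mulrC mulKf// pnatr_eq0 -lt0n.
  by apply/card_gt0P; exists [ffun=> ord0].
move=> x; rewrite /q truncn_le_nat.
have /andP[_ p1] := p01 x.
by apply: le_lt_trans (ler_piMl _ (ltW p1)) _; rewrite ?ltr_nat.
Qed.

(** * Density on the generated field *)

(** Means being linear, it suffices to place the indicators of the field in this span. The empty [G]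
    yields the constant 1, from which complements are formed. *)
Inductive indic_span (R : pzRingType) (F : set (set nat)) : (nat -> R) -> Prop :=
| indic_span_bigcap (G : set (set nat)) : G `<=` F -> finite_set G ->
    indic_span F (\1_(\bigcap_(A in G) A))
| indic_span_lin (a : R) (f g : nat -> R) :
    indic_span F f -> indic_span F g -> indic_span F (fun n => a * f n + g n).

(** Two generators multiply to the generator of [G] union [H]; bilinearity does the rest. *)
Lemma indic_spanM (R : comPzRingType) (F : set (set nat)) (f g : nat -> R) :
  indic_span F f -> indic_span F g -> indic_span F (fun n => f n * g n).
Proof.
move=> Ff Fg; elim: Ff => [G GF Gfin|a u v _ IHu _ IHv].
  elim: Fg => [H HF Hfin|b u v _ IHu _ IHv].
    have -> : (fun n => \1_(\bigcap_(A in G) A) n * \1_(\bigcap_(A in H) A) n) =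
        \1_(\bigcap_(A in G `|` H) A) :> (nat -> R).
      by rewrite bigcap_setU indicI.
    by apply: indic_span_bigcap; rewrite ?subUset// finite_setU.
  under eq_fun do rewrite mulrDr mulrCA.
  exact: indic_span_lin.
under eq_fun do rewrite mulrDl -mulrA.
exact: indic_span_lin.
Qed.

(** Complements subtract from 1, and unions reduce to products by De Morgan. *)
Lemma indic_span_field (R : comPzRingType) (F : set (set nat)) :
  field_of_sets [set A | indic_span F (\1_A : nat -> R)].
Proof.
have span1 : indic_span F (\1_setT : nat -> R).
  by rewrite -(bigcap_set0 id); apply: indic_span_bigcap.
have spanC : setC_closed [set A | indic_span F (\1_A : nat -> R)].
  move=> A /= FA.
  suff -> : \1_(~` A) = (fun n => -1 * \1_A n + \1_setT n) :> (nat -> R).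
    exact: indic_span_lin.
  apply/funext => n; rewrite indicT !indicE in_setC mulN1r.
  by case: (n \in A); rewrite /= ?addNr// oppr0 add0r.
split; [|exact: spanC|].
  by rewrite -setCT; exact: (spanC _ span1).
move=> A B /= FA FB; rewrite -(setCK (A `|` B)) setCU; apply: (spanC _ _) => /=.
by rewrite indicI; apply: indic_spanM; [exact: spanC FA|exact: spanC FB].
Qed.

Lemma generated_field_has_density (R : realType) (F : set (set nat)) :
  (forall G : set (set nat), G `<=` F -> finite_set G ->
    has_density R (\bigcap_(A in G) A)) ->
  generated_field F `<=` has_density R.
Proof.
move=> FD.
have mean_cvg (f : nat -> R) : indic_span F f ->
    cvgn (fun n => series f n / n%:R).
  elim=> [G GF Gfin|a u v _ IHu _ IHv].
    by under eq_fun do rewrite -density_ratioE; exact: FD.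
  have -> : (fun n => series (fun n => a * u n + v n) n / n%:R) =
      (fun n => a * (series u n / n%:R) + series v n / n%:R).
    apply/funext => n; rewrite mulrA -mulrDl; congr (_ / _).
    by rewrite /series/= big_split/= big_distrr.
  by apply: is_cvgD => //; exact: is_cvgMr.
move=> A FA; have : indic_span F (\1_A : nat -> R).
  apply: (smallest_sub (indic_span_field R F) _ FA) => B FB /=.
  rewrite -(bigcap_set1 id B); apply: indic_span_bigcap => //.
  by move=> _ ->.
rewrite /has_density (funext (@density_ratioE R A)).
exact: mean_cvg.
Qed.

(* The index type I stands for the ordinals below the continuum: any type of
   cardinality 2^aleph_0. *)
Theorem proposition2p1 (R : realType) (I : Type)
    (cardI : [set: I] #= [set: set nat])
    (p : I -> R) (p01 : forall i : I, 0 < p i < 1) :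
  exists A : I -> set nat,
    [/\ injective A,
        d_independent R (range A) &
        forall i : I, density R (A i) = p i].
Proof.
have /card_set_bijP[e [_ einj esurj]] := cardI.
(* Passing to [{classic I}] gives the indices a decidable equality, which [uniq] requires. *)
have {}einj : injective (e : {classic I} -> set nat).
  by move=> i j; apply: einj; rewrite inE.
(* The cost fed to [slow_stage] is the bound of [staged_series_le], the period of stage [k] being
   the number of its patterns. *)
have [K [K0 KS KV Koo]] :=
  slow_stage (fun m => \sum_(k < m.+1) 2 * #|stage_type k|)%N.
pose A (i : {classic I}) := staged_set K (e i) (p i).
have Adens (s : seq {classic I}) : uniq s ->
    density_ratio R (\big[setI/setT]_(i <- s) A i) n @[n --> \oo] -->
    \prod_(i <- s) p i.
  exact: cvg_density_staged.
have Adens1 i : density_ratio R (A i) n @[n --> \oo] --> p i.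
  by have := Adens [:: i] isT; rewrite !big_seq1.
have densA i : density R (A i) = p i by apply: cvg_lim (Adens1 i).
have Ainj : injective A.
  (* If [A i = A j] with distinct indices, this set has density both [p i] and [p i * p j], which is
     smaller as [p j < 1]. *)
  move=> i j Aij; apply: contrapT => /eqP ij.
  have := Adens [:: i; j]; rewrite /= inE ij => /(_ isT).
  rewrite !big_cons !big_nil setIT mulr1 -Aij setIid => Aii.
  have pp : p i = p i * p j by rewrite -[LHS]densA; apply: cvg_lim Aii.
  have /andP[pi0 _] := p01 i; have /andP[_ pj1] := p01 j.
  by move: pp => /eqP; rewrite gt_eqF// gtr_pMr.
(* [Adens] speaks of duplicate-free lists of indices, so preimages are chosen along a duplicate-free
   enumeration of [G]. *)
have finite_range (G : set (set nat)) : G `<=` range A -> finite_set G ->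
    exists2 s : seq {classic I}, uniq s & G = [set` [seq A i | i <- s]].
  move=> GA /finite_seqP[t Gt]; rewrite {}Gt in GA *.
  suff [s ts] : exists s, undup t = [seq A i | i <- s].
    exists s; first by rewrite -(map_inj_uniq Ainj) -ts undup_uniq.
    by rewrite -ts; apply/seteqP; split=> B /=; rewrite mem_undup.
  have {GA} : {subset undup t <= range A}.
    by move=> B; rewrite mem_undup => Bt; rewrite inE; exact: GA.
  elim: (undup t) => [|B u IHu] uA; first by exists [::].
  have [i _ AiB] : range A B by apply: set_mem; apply: uA; exact: mem_head.
  have [|s us] := IHu; first by move=> C Cu; apply: uA; rewrite inE Cu orbT.
  by exists (i :: s); rewrite /= AiB us.
exists A; split=> //; split.
(* Any code, here [set0], has a preimage under [e], so there is an index. *)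
- have [i _ _] := esurj set0 Logic.I.
  by exists (A i), i.
- by move=> _ [i _ <-]; apply/cvg_ex; exists (p i).
- by move=> _ [i _ <-]; rewrite densA.
- apply: generated_field_has_density => G /finite_range GA /GA[s us ->].
  apply/cvg_ex; exists (\prod_(i <- s) p i).
  by rewrite bigcap_seq big_map; exact: Adens.
- move=> G /finite_range GA /GA[s us ->] _.
  rewrite bigcap_seq -fsbig_seq ?map_inj_uniq// !big_map.
  under [RHS]eq_bigr do rewrite densA.
  by apply: cvg_lim (Adens s us).
Qed.
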